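(* Let $\mu>0$ and let $\lambda_1(Y'PY)\ge\lambda_2(Y'PY)\ge\cdots$ be the ordered eigenvalues of $Y'PY$. Set $$\hat k=\max\{k:\ \lambda_k(Y'PY)\ge\mu\}$$ (with $\hat k=0$ if no such $k$ exists). Then the minimizer $\hat A$ of $$\|Y-XB\|_F^2+\mu\, r(B)$$ over all $p\times n$ matrices $B$ is given by $\hat A=\hat B_{\hat k}$, i.e. $\hat B_{\hat k}$ attains the minimum.
   Context: $Y$ is an $m\times n$ real matrix, $X$ an $m\times p$ real matrix, a prime denotes transpose, $r(B)$ is the rank of $B$ and $\|\cdot\|_F$ is the Frobenius norm. $M=X'X$, $M^-$ is its Moore–Penrose inverse, and $P=XM^-X'$ is the projection matrix onto the column space of $X$. The restricted rank estimators $\hat B_k$ (which minimize $\|Y-XB\|_F^2$ over matrices $B$ of rank $k$) are computed as follows: let $V=[v_1,\dots,v_n]$ have as columns orthonormal eigenvectors of the symmetric matrix $Y'PY$ corresponding to its eigenvalues arranged from largest to smallest; let $\hat B=M^-X'Y$ be the least squares estimator; let $W=\hat BV$ and $G=V'$; let $W_k$ consist of the first $k$ columns of $W$ and $G_k$ of the first $k$ rows of $G$; then $\hat B_k=W_kG_k$ (and $\hat B_0=0$). *)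

(* Defs.v *)
From mathcomp Require Import all_boot all_order all_algebra.
From mathcomp Require Import reals.

Set Implicit Arguments.
Unset Strict Implicit.
Unset Printing Implicit Defensive.

Import Order.TTheory GRing.Theory Num.Theory.
Local Open Scope ring_scope.

Definition fnorm (R : realType) (m n : nat) (A : 'M[R]_(m, n)) : R :=
  Num.sqrt (\sum_i \sum_j A i j ^+ 2).

(* The four Penrose equations; they determine N uniquely. MathComp's [pinvmx]
   is only a generalized inverse, not the Moore-Penrose one. *)
Definition moore_penrose (R : realType) (m n : nat)
    (A : 'M[R]_(m, n)) (N : 'M[R]_(n, m)) : Prop :=
  [/\ A *m N *m A = A,
      N *m A *m N = N,
      (A *m N)^T = A *m N &
      (N *m A)^T = N *m A].

(* With multiplicity; the usual lambda_k(A) is [tnth lam i] with i = k - 1. *)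
Definition ordered_eigenvalues (R : realType) (n : nat)
    (A : 'M[R]_n) (lam : n.-tuple R) : Prop :=
  sorted >=%R lam /\ char_poly A = \prod_(x <- lam) ('X - x%:P).

Definition orthonormal_eigenvectors (R : realType) (n : nat)
    (A : 'M[R]_n) (lam : n.-tuple R) (V : 'M[R]_n) : Prop :=
  V^T *m V = 1%:M /\
  forall i : 'I_n, A *m col i V = tnth lam i *: col i V.

(* In the next three definitions N stands for the Moore-Penrose inverse of
   X^T *m X. *)
Definition proj_col (R : realType) (m p : nat)
    (X : 'M[R]_(m, p)) (N : 'M[R]_p) : 'M[R]_m :=
  X *m N *m X^T.

Definition least_squares (R : realType) (m n p : nat)
    (Y : 'M[R]_(m, n)) (X : 'M[R]_(m, p)) (N : 'M[R]_p) : 'M[R]_(p, n) :=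
  N *m X^T *m Y.

(* For k = 0 the inner dimension is 0, so the product is the zero matrix. *)
Definition rank_estimator (R : realType) (m n p : nat)
    (Y : 'M[R]_(m, n)) (X : 'M[R]_(m, p)) (N : 'M[R]_p) (V : 'M[R]_n)
    (k : nat) (le_kn : (k <= n)%N) : 'M[R]_(p, n) :=
  let W := least_squares Y X N *m V in
  let G := V^T in
  colsub (widen_ord le_kn) W *m rowsub (widen_ord le_kn) G.

(* The shift i.+1 accounts for 0-based indexing; an empty maximum is 0. *)
Definition khat (R : realType) (n : nat) (lam : n.-tuple R) (mu : R) : nat :=
  \max_(i < n | mu <= tnth lam i) i.+1.

Lemma khat_le (R : realType) (n : nat) (lam : n.-tuple R) (mu : R) :
  (khat lam mu <= n)%N.
Proof. by apply/bigmax_leqP => i _; apply: ltn_ord. Qed.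

Definition penalized_loss (R : realType) (m n p : nat)
    (Y : 'M[R]_(m, n)) (X : 'M[R]_(m, p)) (mu : R) (B : 'M[R]_(p, n)) : R :=
  fnorm (Y - X *m B) ^+ 2 + mu * (\rank B)%:R.

(* Main.v *)
(** With [P] the orthogonal projector onto the column space of [X],
    [||Y - XB||^2 = ||Y - PY||^2 + ||PY - XB||^2].  If [Q] projects onto the
    orthogonal complement of the row space of [B], then
    [||PY - XB||^2 >= ||PY Q||^2 = \sum_i lam_i q_i], where the diagonal entries
    [q_i] of [V^T Q V] lie in [0, 1] and add up to [n - r(B)].  Hence
    [||PY - XB||^2 + mu r(B) >= \sum_i (lam_i q_i + mu (1 - q_i))
    >= \sum_i min(lam_i, mu)], and this bound is attained by keeping exactly the
    eigenvectors with [lam_i >= mu]. *)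
Require Import Defs.
From mathcomp Require Import all_boot all_order all_algebra.
From mathcomp Require Import reals.
From mathcomp Require Import lra.

Set Implicit Arguments.
Unset Strict Implicit.
Unset Printing Implicit Defensive.

Import Order.TTheory GRing.Theory Num.Theory.
Local Open Scope ring_scope.

(** * Gram matrices and the Frobenius norm *)

Lemma mxtrace_gram (R : realDomainType) (m n : nat) (A : 'M[R]_(m, n)) :
  \tr (A^T *m A) = \sum_i \sum_j A i j ^+ 2.
Proof.
rewrite exchange_big; apply: eq_bigr => j _; rewrite mxE.
by apply: eq_bigr => i _; rewrite mxE expr2.
Qed.

Lemma mxtrace_gram_ge0 (R : realDomainType) (m n : nat) (A : 'M[R]_(m, n)) :
  0 <= \tr (A^T *m A).
Proof.
by rewrite mxtrace_gram !sumr_ge0// => i _; rewrite sumr_ge0// => j _; rewrite sqr_ge0.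
Qed.

Lemma gram_eq0 (R : realDomainType) (m n : nat) (A : 'M[R]_(m, n)) :
  A^T *m A = 0 -> A = 0.
Proof.
move=> A0; have := mxtrace_gram A; rewrite A0 mxtrace0 => /esym/eqP.
rewrite psumr_eq0 => [/allP rows0|i _]; last first.
  by rewrite sumr_ge0// => j _; rewrite sqr_ge0.
apply/matrixP => i j; rewrite mxE; have := rows0 i (mem_index_enum _).
rewrite psumr_eq0 => [/allP/(_ j (mem_index_enum _))|k _]; last exact: sqr_ge0.
by rewrite /= sqrf_eq0 => /eqP.
Qed.

Lemma fnorm_sqr (R : realType) (m n : nat) (A : 'M[R]_(m, n)) :
  fnorm A ^+ 2 = \tr (A^T *m A).
Proof. by rewrite /fnorm sqr_sqrtr -mxtrace_gram// mxtrace_gram_ge0. Qed.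

(** * Orthogonal projectors *)

Definition orthogonal_projector (R : pzRingType) (n : nat) (Q : 'M[R]_n) : Prop :=
  Q^T = Q /\ Q *m Q = Q.

Lemma orthogonal_projectorC (R : pzRingType) (n : nat) (Q : 'M[R]_n) :
  orthogonal_projector Q -> orthogonal_projector (1%:M - Q).
Proof.
move=> [QT QQ]; split; first by rewrite linearB /= trmx1 QT.
by rewrite mulmxBl !mulmxBr !mul1mx mulmx1 QQ subrr subr0.
Qed.

Lemma orthogonal_projector_conj (R : comPzRingType) (n : nat) (V Q : 'M[R]_n) :
  V *m V^T = 1%:M ->
  orthogonal_projector Q -> orthogonal_projector (V^T *m Q *m V).
Proof.
move=> VV [QT QQ]; split; first by rewrite !trmx_mul trmxK QT mulmxA.
by rewrite mulmxA -[_ *m V *m (_ *m _)]mulmxA (mulmxA V) VV mul1mx -[_ *m Q *m Q]mulmxA QQ.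
Qed.

(** Since [Q = Q^T *m Q], a diagonal entry is the squared norm of a column. *)
Lemma orthogonal_projector_diag_ge0 (R : realDomainType) (n : nat)
    (Q : 'M[R]_n) (i : 'I_n) :
  orthogonal_projector Q -> 0 <= Q i i.
Proof.
move=> [QT QQ]; rewrite -QQ -{1}QT mxE sumr_ge0// => j _.
by rewrite mxE -expr2 sqr_ge0.
Qed.

Lemma orthogonal_projector_diag_le1 (R : realDomainType) (n : nat)
    (Q : 'M[R]_n) (i : 'I_n) :
  orthogonal_projector Q -> Q i i <= 1.
Proof.
move=> /orthogonal_projectorC/(@orthogonal_projector_diag_ge0 _ _ _ i).
by rewrite !mxE eqxx subr_ge0.
Qed.

Lemma mxtrace_gram_projr (R : comPzRingType) (m n : nat)
    (A : 'M[R]_(m, n)) (Q : 'M[R]_n) :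
  orthogonal_projector Q -> \tr ((A *m Q)^T *m (A *m Q)) = \tr (A^T *m A *m Q).
Proof.
move=> [QT QQ].
rewrite trmx_mul QT mxtrace_mulC mulmxA -[_ *m Q *m Q]mulmxA QQ.
by rewrite mxtrace_mulC mulmxA.
Qed.

(** The difference of the two sides is the squared norm of [A *m (1%:M - Q)]. *)
Lemma mxtrace_gram_projr_le (R : realDomainType) (m n : nat)
    (A : 'M[R]_(m, n)) (Q : 'M[R]_n) :
  orthogonal_projector Q ->
  \tr ((A *m Q)^T *m (A *m Q)) <= \tr (A^T *m A).
Proof.
move=> prQ; have trC := mxtrace_gram_projr A (orthogonal_projectorC prQ).
have := mxtrace_gram_ge0 (A *m (1%:M - Q)).
by rewrite trC mulmxBr mulmx1 linearB /= subr_ge0 mxtrace_gram_projr.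
Qed.

Lemma mxtrace_gramD (R : comPzRingType) (m n : nat) (A B : 'M[R]_(m, n)) :
  A^T *m B = 0 ->
  \tr ((A + B)^T *m (A + B)) = \tr (A^T *m A) + \tr (B^T *m B).
Proof.
move=> AB; have BA : B^T *m A = 0 by rewrite -[LHS]trmxK trmx_mul trmxK AB trmx0.
by rewrite [(A + B)^T]linearD /= mulmxDl !mulmxDr AB BA addr0 add0r linearD.
Qed.

(** If [x *m K *m K^T = 0], then [x *m K] has zero Gram matrix, so it vanishes, and [x = 0] by row
    freeness. *)
Lemma row_free_gram_unit (R : realFieldType) (r n : nat) (K : 'M[R]_(r, n)) :
  row_free K -> K *m K^T \in unitmx.
Proof.
move=> Kfree; rewrite -row_free_unit -kermx_eq0; apply/eqP.
have kerK : kermx (K *m K^T) *m K = 0.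
  apply: trmx_inj; rewrite trmx0; apply: gram_eq0.
  by rewrite trmxK trmx_mul !mulmxA -[_ *m K *m _]mulmxA mulmx_ker mul0mx.
by apply: (row_free_inj Kfree); rewrite kerK mul0mx.
Qed.

(** For a row base [K] of [B], the projector onto the row space is [H = K^T (K K^T)^-1 K]; cyclicity
    of the trace gives [\tr H = \rank B]. The witness is [1 - H]. *)
Lemma row_space_complement_projector (R : realFieldType) (p n : nat)
    (B : 'M[R]_(p, n)) :
  exists Q : 'M[R]_n,
    [/\ orthogonal_projector Q, B *m Q = 0 & \tr Q = n%:R - (\rank B)%:R].
Proof.
have := row_base_free B; have := mulmx_base B.
move: (col_base B) (row_base B) => C K BE Kfree.
pose H := K^T *m invmx (K *m K^T) *m K.
have Ku := row_free_gram_unit Kfree.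
have KH : K *m H = K by rewrite /H !mulmxA mulmxV ?mul1mx.
have prH : orthogonal_projector H.
  split; last by rewrite {1}/H -[_ *m K *m H]mulmxA KH.
  by rewrite /H !trmx_mul trmxK trmx_inv trmx_mul trmxK mulmxA.
exists (1%:M - H); split; first exact: orthogonal_projectorC.
  by rewrite mulmxBr mulmx1 -BE -mulmxA KH subrr.
by rewrite linearB /= mxtrace1 /H mxtrace_mulC mulmxA mulmxV ?mxtrace1.
Qed.

(** * The projector onto the column space of [X] *)

(** The difference [D = P X - X] is a left multiple by [X], while [X^T D = 0]; hence [D^T D = 0]. *)
Lemma proj_col_mul (R : realType) (m p : nat)
    (X : 'M[R]_(m, p)) (N : 'M[R]_p) :
  X^T *m X *m N *m (X^T *m X) = X^T *m X -> proj_col X N *m X = X.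
Proof.
move=> hN; apply/eqP; rewrite -subr_eq0; apply/eqP/gram_eq0.
have XD : X^T *m (proj_col X N *m X - X) = 0.
  by rewrite mulmxBr -hN /proj_col !mulmxA subrr.
have {1}-> : proj_col X N *m X - X = X *m (N *m X^T *m X - 1%:M).
  by rewrite mulmxBr mulmx1 /proj_col !mulmxA.
by rewrite trmx_mul -[LHS]mulmxA XD mulmx0.
Qed.

(** The hypothesis is stable under transposing [N], so [P^T] fixes [X] as well. This gives
    [X^T P = X^T], then [P^T P = P^T]; the left side is symmetric, so [P] is too. *)
Lemma proj_col_projector (R : realType) (m p : nat)
    (X : 'M[R]_(m, p)) (N : 'M[R]_p) :
  X^T *m X *m N *m (X^T *m X) = X^T *m X ->
  orthogonal_projector (proj_col X N).
Proof.
move=> hN.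
have PTE : (proj_col X N)^T = proj_col X N^T.
  by rewrite /proj_col !trmx_mul trmxK mulmxA.
have hNT : X^T *m X *m N^T *m (X^T *m X) = X^T *m X.
  by rewrite -[RHS]trmxK trmx_mul trmxK -[in RHS]hN !trmx_mul trmxK !mulmxA.
have XTP : X^T *m proj_col X N = X^T.
  by rewrite -[LHS]trmxK trmx_mul trmxK PTE proj_col_mul.
have PTP : (proj_col X N)^T *m proj_col X N = (proj_col X N)^T.
  by rewrite PTE {1}/proj_col -mulmxA XTP.
have PT : (proj_col X N)^T = proj_col X N.
  by have := congr1 trmx PTP; rewrite trmx_mul !trmxK PTP => ->.
by split=> //; rewrite -{1}PT PTP.
Qed.

(** * The threshold index and traces in an eigenbasis *)

(** As [lam] is nonincreasing, the indices with [mu <= lam_i] form an initial segment. *)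
Lemma ltn_khat (R : realType) (n : nat) (lam : n.-tuple R) (mu : R) (i : 'I_n) :
  sorted >=%R lam -> (i < khat lam mu)%N = (mu <= tnth lam i).
Proof.
move=> slam; apply/idP/idP => [|le_mu]; last first.
  exact: (@leq_bigmax_cond _ _ (fun j : 'I_n => j.+1)).
(* Induction over the maximum: some [j] with [mu <= lam_j] must satisfy [i < j.+1], that is
   [i <= j]. *)
rewrite /khat; elim/big_ind: _ => [//|a b IHa IHb|j le_mu].
  by rewrite leq_max => /orP[/IHa|/IHb].
rewrite ltnS => le_ij; apply: le_trans le_mu _.
rewrite !(tnth_nth 0); have := le_ij.
by apply: (sorted_leq_nth ge_trans ge_refl); rewrite // inE size_tuple.
Qed.

Lemma min_le_convex (R : realDomainType) (a b t : R) :
  0 <= t <= 1 -> Num.min a b <= a * t + b * (1 - t).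
Proof.
by move=> /andP[t0 t1]; case: (leP a b) => ab; nra.
Qed.

Lemma mxtrace_mul_diagonalized (R : comPzRingType) (n : nat)
    (A V T : 'M[R]_n) (lam : 'I_n -> R) :
  (forall i, A *m col i V = lam i *: col i V) -> V *m V^T = 1%:M ->
  \tr (A *m T) = \sum_i lam i * (V^T *m T *m V) i i.
Proof.
move=> eigV VV.
have AV : A *m V = V *m diag_mx (\row_i lam i).
  apply/matrixP => i j.
  have := eigV j; rewrite colE mulmxA -!colE => /colP/(_ i).
  by rewrite mul_mx_diag !mxE => ->; rewrite mulrC.
rewrite -[A]mulmx1 -VV mulmxA AV -!mulmxA mxtrace_mulC -!mulmxA.
by rewrite mul_diag_mx; apply: eq_bigr => i _; rewrite [LHS]mxE mxE.
Qed.

(** Conjugation by [V] preserves the trace, so [n - \tr Q], which will stand for a rank, also splits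
    over the eigenvectors. *)
Lemma penalized_trace_diagonalized (R : comPzRingType) (n : nat)
    (A V Q : 'M[R]_n) (lam : 'I_n -> R) (mu : R) :
  (forall i, A *m col i V = lam i *: col i V) -> V *m V^T = 1%:M ->
  \tr (A *m Q) + mu * (n%:R - \tr Q) =
  \sum_i (lam i * (V^T *m Q *m V) i i + mu * (1 - (V^T *m Q *m V) i i)).
Proof.
move=> eigV VV; rewrite (mxtrace_mul_diagonalized _ eigV VV) big_split /=.
congr (_ + _); rewrite -mulr_sumr sumrB; congr (_ * (_ - _)).
  by rewrite sumr_const card_ord.
by rewrite -[RHS]/(\tr _) mxtrace_mulC mulmxA VV mul1mx.
Qed.

(** Row [i] of [E] is a unit vector for [i < k] and zero otherwise. *)
Lemma colsub_mul_trmx_diag (R : pzRingType) (n k : nat) (le_kn : (k <= n)%N)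
    (i : 'I_n) :
  let E : 'M[R]_(n, k) := colsub (widen_ord le_kn) 1%:M in
  (E *m E^T) i i = (i < k)%N%:R.
Proof.
rewrite /= mxE; have [lt_ik|le_ki] := ltnP i k.
  rewrite (bigD1 (Ordinal lt_ik)) //= big1 ?addr0 => [|j ne_j].
    by rewrite !mxE -val_eqE /= eqxx mulr1.
  rewrite !mxE -val_eqE /= (_ : _ == _ = false) ?mul0r //.
  by apply: contraNF ne_j => /eqP eq_ij; apply/eqP/val_inj.
rewrite big1 // => j _; rewrite !mxE -val_eqE /= gtn_eqF ?mul0r //.
exact: leq_trans (ltn_ord j) le_ki.
Qed.

(** * Lower bound on the loss *)

Lemma residual_decomposition (R : realType) (m n p : nat)
    (Y : 'M[R]_(m, n)) (X : 'M[R]_(m, p)) (N : 'M[R]_p) (B : 'M[R]_(p, n)) :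
  X^T *m X *m N *m (X^T *m X) = X^T *m X ->
  fnorm (Y - X *m B) ^+ 2 =
  fnorm (Y - proj_col X N *m Y) ^+ 2 + fnorm (proj_col X N *m Y - X *m B) ^+ 2.
Proof.
move=> hN; have [PT PP] := proj_col_projector hN.
rewrite !fnorm_sqr -mxtrace_gramD ?addrA ?subrK //.
(* As [P X = X], the second summand lies in the range of [P], to which [Y - P Y] is orthogonal. *)
have -> : proj_col X N *m Y - X *m B = proj_col X N *m (Y - X *m B).
  by rewrite mulmxBr mulmxA proj_col_mul.
by rewrite mulmxA [(Y - _)^T]linearB /= mulmxBl trmx_mul PT -mulmxA PP subrr mul0mx.
Qed.

Lemma fnorm_proj_projr (R : realType) (m n : nat)
    (Y : 'M[R]_(m, n)) (P : 'M[R]_m) (Q : 'M[R]_n) :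
  orthogonal_projector P -> orthogonal_projector Q ->
  fnorm (P *m Y *m Q) ^+ 2 = \tr (Y^T *m P *m Y *m Q).
Proof.
move=> [PT PP] prQ; rewrite fnorm_sqr mxtrace_gram_projr // trmx_mul PT.
by rewrite mulmxA -[_ *m P *m P]mulmxA PP.
Qed.

Lemma penalized_loss_ge (R : realType) (m n p : nat)
    (Y : 'M[R]_(m, n)) (X : 'M[R]_(m, p)) (mu : R) (N : 'M[R]_p)
    (lam : 'I_n -> R) (V : 'M[R]_n) (B : 'M[R]_(p, n)) :
  let P := proj_col X N in
  X^T *m X *m N *m (X^T *m X) = X^T *m X ->
  V *m V^T = 1%:M ->
  (forall i, Y^T *m P *m Y *m col i V = lam i *: col i V) ->
  fnorm (Y - P *m Y) ^+ 2 + \sum_i Num.min (lam i) mu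
    <= penalized_loss Y X mu B.
Proof.
move=> P hN VV eigV; rewrite /penalized_loss (residual_decomposition _ _ hN).
rewrite -addrA lerD2l.
have [Q [prQ BQ trQ]] := row_space_complement_projector B.
have -> : (\rank B)%:R = n%:R - \tr Q :> R by rewrite trQ subKr.
apply: (@le_trans _ _ (\tr (Y^T *m P *m Y *m Q) + mu * (n%:R - \tr Q))).
  rewrite (penalized_trace_diagonalized _ _ eigV VV); apply: ler_sum => i _.
  have prT := orthogonal_projector_conj VV prQ.
  apply: min_le_convex.
  by rewrite orthogonal_projector_diag_ge0 // orthogonal_projector_diag_le1.
(* Since [B Q = 0], [P Y Q] is the residual [P Y - X B] projected by [Q], so its norm is no
   larger. *)
rewrite lerD2r -fnorm_proj_projr //; last exact: proj_col_projector.
have -> : P *m Y *m Q = (P *m Y - X *m B) *m Q.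
  by rewrite [RHS]mulmxBl -[X *m B *m Q]mulmxA BQ mulmx0 subr0.
by rewrite !fnorm_sqr mxtrace_gram_projr_le.
Qed.

(** * Loss of the restricted rank estimator *)

(** For orthonormal [V], [J *m J^T] projects onto the span of the first [k] eigenvectors. *)
Lemma rank_estimatorE (R : realType) (m n p : nat)
    (Y : 'M[R]_(m, n)) (X : 'M[R]_(m, p)) (N : 'M[R]_p) (V : 'M[R]_n)
    (k : nat) (le_kn : (k <= n)%N) :
  let J := colsub (widen_ord le_kn) V in
  rank_estimator Y X N V le_kn = least_squares Y X N *m (J *m J^T).
Proof.
by rewrite /rank_estimator -mulmx_colsub -mulmxA trmx_mxsub.
Qed.

Lemma penalized_loss_rank_estimator_le (R : realType) (m n p : nat)
    (Y : 'M[R]_(m, n)) (X : 'M[R]_(m, p)) (mu : R) (N : 'M[R]_p)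
    (lam : 'I_n -> R) (V : 'M[R]_n) (k : nat) (le_kn : (k <= n)%N) :
  let P := proj_col X N in
  0 <= mu ->
  X^T *m X *m N *m (X^T *m X) = X^T *m X ->
  V^T *m V = 1%:M ->
  (forall i, Y^T *m P *m Y *m col i V = lam i *: col i V) ->
  penalized_loss Y X mu (rank_estimator Y X N V le_kn) <=
  fnorm (Y - P *m Y) ^+ 2 + \sum_(i < n) (if (i < k)%N then mu else lam i).
Proof.
move=> P mu0 hN VtV eigV; have VV := mulmx1C VtV.
rewrite /penalized_loss (residual_decomposition _ _ hN) -addrA lerD2l.
(* The rank may be smaller than [k]; as [mu >= 0], replacing it by [k] only increases the
   penalty. *)
have rk : (\rank (rank_estimator Y X N V le_kn) <= k)%N.
  by rewrite (leq_trans (mulmx_max_rank _ _)).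
apply: (@le_trans _ _ (fnorm (P *m Y - X *m rank_estimator Y X N V le_kn) ^+ 2
  + mu * k%:R)); first by rewrite lerD2l ler_wpM2l ?ler_nat.
rewrite rank_estimatorE; set J := colsub _ V.
pose E : 'M[R]_(n, k) := colsub (widen_ord le_kn) 1%:M.
have VJ : V^T *m J = E by rewrite /J mulmx_colsub VtV.
have JJ : J^T *m J = 1%:M.
  have -> : J^T *m J = E^T *m E.
    by rewrite -VJ trmx_mul trmxK mulmxA -[_ *m V *m _]mulmxA VV mulmx1.
  rewrite {2}/E mulmx_colsub mulmx1; apply/matrixP => i j.
  by rewrite !mxE eq_sym -val_eqE.
have prJ : orthogonal_projector (J *m J^T).
  by split; [rewrite trmx_mul trmxK|rewrite mulmxA -[J *m _ *m J]mulmxA JJ mulmx1].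
have prC := orthogonal_projectorC prJ.
(* The fitted values [X *m least_squares Y X N] are [P Y], so the residual is the part of [P Y] in
   the discarded directions. *)
have -> : P *m Y - X *m (least_squares Y X N *m (J *m J^T))
          = P *m Y *m (1%:M - J *m J^T).
  by rewrite mulmxBr mulmx1 /least_squares /P /proj_col !mulmxA.
rewrite fnorm_proj_projr //; last exact: proj_col_projector.
have trJ : k%:R = n%:R - \tr (1%:M - J *m J^T) :> R.
  by rewrite linearB /= mxtrace1 subKr mxtrace_mulC JJ mxtrace1.
rewrite trJ (penalized_trace_diagonalized _ _ eigV VV); apply: ler_sum => i _.
(* In the eigenbasis the complementary projector has diagonal entry 0 for [i < k], leaving [mu], and
   1 otherwise, leaving [lam i]. *)
have -> : V^T *m (1%:M - J *m J^T) *m V = 1%:M - E *m E^T.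
  by rewrite -VJ trmx_mul trmxK mulmxBr mulmx1 mulmxBl VtV !mulmxA.
have diagE : (1%:M - E *m E^T) i i = 1 - (i < k)%N%:R.
  by rewrite 3!mxE eqxx colsub_mul_trmx_diag.
by rewrite diagE; case: ifP => _ /=; lra.
Qed.

Theorem proposition1 (R : realType) (m n p : nat)
    (Y : 'M[R]_(m, n)) (X : 'M[R]_(m, p)) (mu : R)
    (N : 'M[R]_p) (lam : n.-tuple R) (V : 'M[R]_n)
    (mu_gt0 : 0 < mu)
    (hN : moore_penrose (X^T *m X) N)
    (hlam : ordered_eigenvalues (Y^T *m proj_col X N *m Y) lam)
    (hV : orthonormal_eigenvectors (Y^T *m proj_col X N *m Y) lam V) :
  forall B : 'M[R]_(p, n),
    penalized_loss Y X mu (rank_estimator Y X N V (khat_le lam mu))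
      <= penalized_loss Y X mu B.
Proof.
move=> B; case: hN => ginvN _ _ _; case: hV => VtV eigV.
have := penalized_loss_rank_estimator_le (khat_le lam mu) (ltW mu_gt0) ginvN VtV eigV.
move=> upper; apply: le_trans upper _.
apply: le_trans (penalized_loss_ge mu B ginvN (mulmx1C VtV) eigV).
(* At [k = khat lam mu] the test [i < k] means [mu <= lam_i], so the conditional is the minimum and
   the two bounds meet. *)
rewrite lerD2l; apply: ler_sum => i _; case: hlam => slam _.
by rewrite ltn_khat //; case: (leP mu (tnth lam i)).
Qed.
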